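(* Let $\mu,\kappa>0$. There exist $\widehat{k}>\frac18$ and $k>0$ such that for all $\sigma_y\in\mathbb{R}$ with $$0<\sigma_y^2\le \frac{3\,\mu\,\kappa}{e}\,\frac{8\widehat{k}-1}{\widehat{k}}\;e^{\,k\,\frac{\kappa}{e\,\mu}\,\frac{8\widehat{k}-1}{\widehat{k}}}$$ the TSTS-M$^+$ inequality for the energy $W_{\rm eH}$ with parameters $\mu,\kappa,k,\widehat{k}$ is satisfied for all $V\in\mathrm{PSym}(3)$ with $\|\mathrm{dev}_3\,\tau_{\rm eH}(\log V)\|^2\le\frac23\sigma_y^2$; that is, $$\langle\sigma_{\rm eH}(\log V_1)-\sigma_{\rm eH}(\log V_2),\,\log V_1-\log V_2\rangle>0$$ for all $V_1\neq V_2$ in $\{V\in\mathrm{PSym}(3):\|\mathrm{dev}_3\,\tau_{\rm eH}(\log V)\|^2\le\frac23\sigma_y^2\}$.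
   Context: $\mathrm{PSym}(3)$ denotes the real symmetric positive definite $3\times3$ matrices; $\langle X,Y\rangle=\mathrm{tr}(XY^T)$, $\|X\|^2=\langle X,X\rangle$, $\mathrm{dev}_3X=X-\frac13\mathrm{tr}(X)I$ with $I$ the identity matrix. For the exponentiated Hencky energy $W_{\rm eH}(\log V)=\frac{\mu}{k}e^{k\|\mathrm{dev}_3\log V\|^2}+\frac{\kappa}{2\widehat{k}}e^{\widehat{k}(\mathrm{tr}\log V)^2}$, the Kirchhoff and Cauchy stresses as functions of $X=\log V$ are $$\tau_{\rm eH}(X)=2\mu\,e^{k\|\mathrm{dev}_3 X\|^2}\,\mathrm{dev}_3 X+\kappa\,e^{\widehat{k}[\mathrm{tr}(X)]^2}\,\mathrm{tr}(X)\, I,\qquad \sigma_{\rm eH}(X)=e^{-\mathrm{tr}(X)}\,\tau_{\rm eH}(X).$$ TSTS-M$^+$ (true-stress-true-strain monotonicity) is strict monotonicity of the Cauchy stress as a function of the logarithmic strain. *)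

(* Defs.v *)
From HB Require Import structures.
From mathcomp Require Import all_boot all_order all_algebra.
From mathcomp Require Import all_classical all_reals all_analysis.

Set Implicit Arguments.
Unset Strict Implicit.
Unset Printing Implicit Defensive.

Import Order.TTheory GRing.Theory Num.Theory.
Local Open Scope classical_set_scope.
Local Open Scope ring_scope.

Definition PSym3 (R : realType) : set 'M[R]_3 :=
  [set V | V^T = V /\ forall x : 'rV[R]_3, x != 0 -> 0 < (x *m V *m x^T) 0 0].

Definition mxdot (R : realType) (X Y : 'M[R]_3) : R := \tr (X *m Y^T).

Definition mxnorm2 (R : realType) (X : 'M[R]_3) : R := mxdot X X.

Definition dev3 (R : realType) (X : 'M[R]_3) : 'M[R]_3 :=
  X - (3^-1 * \tr X) *: 1%:M.

(* X is obtained from an orthogonal diagonalization of V by applying ln to the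
   eigenvalues. *)
Definition is_logmx (R : realType) (V X : 'M[R]_3) : Prop :=
  exists (Q : 'M[R]_3) (d : 'rV[R]_3),
    [/\ Q *m Q^T = 1%:M,
        forall i, 0 < d 0 i,
        V = Q *m diag_mx d *m Q^T &
        X = Q *m diag_mx (map_mx (@ln R) d) *m Q^T].

(* For V in PSym3, the spectral theorem gives an X with is_logmx V X, and X does
   not depend on the chosen diagonalization; so logmx V is the principal matrix
   logarithm of V. The default value 0 is used only for V outside PSym3. *)
Definition logmx (R : realType) (V : 'M[R]_3) : 'M[R]_3 :=
  xget 0 [set X | is_logmx V X].

(* tau_eH is the derivative with respect to X = log V of the exponentiated
   Hencky energy
   mu / k * exp (k |dev3 X|^2) + kappa / (2 khat) * exp (khat (tr X)^2). *)
Definition tau_eH (R : realType) (mu kappa k khat : R) (X : 'M[R]_3) :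
    'M[R]_3 :=
  (2 * mu * expR (k * mxnorm2 (dev3 X))) *: dev3 X
  + (kappa * expR (khat * (\tr X) ^+ 2) * \tr X) *: 1%:M.

Definition sigma_eH (R : realType) (mu kappa k khat : R) (X : 'M[R]_3) :
    'M[R]_3 :=
  expR (- \tr X) *: tau_eH mu kappa k khat X.

(* The TSTS-M+ inequality on D, for a Cauchy stress sigma given as a function of
   the logarithmic strain. *)
Definition tsts_mplus_on (R : realType) (sigma : 'M[R]_3 -> 'M[R]_3)
    (D : set 'M[R]_3) : Prop :=
  forall V1 V2 : 'M[R]_3, D V1 -> D V2 -> V1 <> V2 ->
    0 < mxdot (sigma (logmx V1) - sigma (logmx V2)) (logmx V1 - logmx V2).

Definition elastic_domain (R : realType) (mu kappa k khat sigma_y : R) :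
    set 'M[R]_3 :=
  [set V | PSym3 V /\
    mxnorm2 (dev3 (tau_eH mu kappa k khat (logmx V)))
      <= 2 / 3 * sigma_y ^+ 2].

(* Main.v *)
Require Import Defs.
From HB Require Import structures.
From mathcomp Require Import all_boot all_order all_algebra.
From mathcomp Require Import all_classical all_reals all_analysis.
From mathcomp Require Import complex ring lra.

Import Order.TTheory GRing.Theory Num.Theory.
Import numFieldNormedType.Exports.
Local Open Scope classical_set_scope.
Local Open Scope ring_scope.

(** Write X = log V, s = |dev3 X|^2 and T = tr X.

    The yield condition is a ball condition on the deviatoric strain: since
    |dev3 tau|^2 = 4 mu^2 s exp (2 k s) increases with s, the bound on sigma_y
    says that s <= s0, where s0 = kappa c / (2 e mu) and
    c = (8 khat - 1) / khat. The set of such X is convex, so strict monotonicity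
    follows once the derivative of sigma is positive along every segment of it.

    In a direction H, with h = tr H, E = dev3 H and P = <dev3 X, E>, that
    derivative is exp (- T) times
      2 mu exp (k s) (|E|^2 - h P + 2 k P^2)
        + kappa exp (khat T^2) (1 - T + 2 khat T^2) h^2.
    The only term that can be negative is the cross term h P, which comes from
    the factor exp (- T) of the Cauchy stress. Since
    1 - T + 2 khat T^2 >= 1 - 1 / (8 khat) = c / 8 and P^2 <= s |E|^2, the
    discriminant of the quadratic form is negative as soon as
    mu s exp (k s) < kappa c / 4 (lemma [tangent_gt0]); by monotonicity this is
    needed only at s = s0, where it reads exp (k s0) < e / 2. As e > 2, every
    small enough k does it, for any khat; the proof takes khat = 1/4 and
    k = 1 / (8 s0).

    It remains to see that distinct V in PSym3 have distinct logarithms. This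
    uses the real spectral theorem [real_spectral], by which [logmx] is a genuine
    logarithm on PSym3, and the fact that applying a function to the eigenvalues
    does not depend on the diagonalization ([orthogonal_diag_map]), which recovers
    V from X through the exponential. *)

(** * The real spectral theorem *)

Lemma rv_sqnorm_gt0 {R : realDomainType} {n : nat} (u : 'rV[R]_n) :
  u != 0 -> 0 < (u *m u^T) 0 0.
Proof.
move=> u0; have sq i : 0 <= u 0 i * u^T i 0 by rewrite mxE -expr2 sqr_ge0.
rewrite lt_def mxE sumr_ge0 // andbT psumr_eq0 //.
apply: contra u0 => /allP u0; apply/eqP/rowP => i; rewrite [RHS]mxE.
by have := u0 i (mem_index_enum i); rewrite mxE /= -expr2 sqrf_eq0 => /eqP.
Qed.

(** An eigenvalue exists over the complex field R[i]; computing v A v* from the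
    left and from the right shows that it equals its own conjugate. *)
Lemma symmetric_eigenvalue {R : rcfType} {n : nat} (A : 'M[R]_n.+1) :
  A^T = A -> exists a, eigenvalue A a.
Proof.
move=> symA; pose Ac := map_mx (real_complex R) A.
have [a /eigenvalueP[v vA v0]] := @eigenvalue_closed R[i] _ Ac isT.
have AcH : map_mx Num.conj Ac^T = Ac.
  rewrite /Ac map_trmx symA; apply/matrixP => i j; rewrite !mxE.
  by apply/CrealP/complex_realP; exists (A i j).
pose vs := map_mx Num.conj v^T.
have vvs : v *m vs != 0.
  have := dotmx_is_dotmx v0; rewrite dotmxE => /gt_eqF/negbT.
  by apply: contra => /eqP; rewrite /vs => ->; rewrite mxE.
have Avs : Ac *m vs = Num.conj a *: vs.
  by rewrite -{1}AcH -map_mxM -trmx_mul vA linearZ map_mxZ.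
have /complex_realP[b ab] : a \is Num.real.
  apply/CrealP/eqP; rewrite -subr_eq0 -(orbF (_ == 0)) -(negbTE vvs).
  by rewrite -scaler_eq0 scalerBl (scalemxAl a) -vA scalemxAr -Avs mulmxA subrr.
exists b; rewrite -(eigenvalue_map (real_complex R)) /= -/(real_complex R b) -ab.
by apply/eigenvalueP; exists v.
Qed.

(** The witness is the Householder reflection that exchanges u and the first basis
    vector e, that is, the reflection along v = u - e. *)
Lemma orthogonal_first_row {R : realFieldType} {n : nat} (u : 'rV[R]_(1 + n)) :
  u *m u^T = 1%:M ->
  exists2 H : 'M[R]_(1 + n), H *m H^T = 1%:M & delta_mx 0 0 *m H = u.
Proof.
move=> uu; pose e : 'rV[R]_(1 + n) := delta_mx 0 0.
have ee : e *m e^T = 1%:M.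
  by rewrite /e trmx_delta mul_delta_mx; apply/matrixP=> i j; rewrite !mxE !ord1.
have [->|ue] := eqVneq u e.
  by exists 1%:M; rewrite ?trmx1 mulmx1.
pose v := u - e.
have v0 : v != 0 by rewrite subr_eq0.
pose c := (v *m v^T) 0 0.
have c0 : c != 0 by rewrite gt_eqF// rv_sqnorm_gt0.
have vv : v *m v^T = c%:M by rewrite [LHS]mx11_scalar.
pose H := 1%:M - (2 / c) *: (v^T *m v).
have HT : H^T = H by rewrite /H linearB linearZ /= trmx1 trmx_mul trmxK.
exists H.
  rewrite HT {2}/H mulmxBr mulmx1 -scalemxAr mulmxA.
  have -> : H *m v^T = - v^T.
    rewrite mulmxBl mul1mx -scalemxAl -mulmxA vv mul_mx_scalar scalerA.
    by rewrite divfK// scaler_nat mulr2n opprD addNKr.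
  by rewrite mulNmx scalerN opprK subrK.
rewrite mulmxBr mulmx1 -scalemxAr mulmxA.
(* |u| = |e| puts the hyperplane orthogonal to v halfway between e and u *)
suff -> : e *m v^T = (- (c / 2))%:M.
  rewrite mul_scalar_mx scalerA mulrN mulrA divfK// mulfV ?pnatr_eq0//.
  by rewrite scaleN1r opprK /v addrC subrK.
have eu : u *m e^T = e *m u^T.
  by rewrite -[LHS]trmxK trmx_mul trmxK [e *m _]mx11_scalar tr_scalar_mx.
move: vv; rewrite /v linearB /= !mulmxBr !mulmxBl uu ee eu => vv.
apply/matrixP => i j; rewrite !ord1; move/matrixP/(_ 0 0): vv; rewrite !mxE !eqxx.
by move=> vv; lra.
Qed.

(** Induction on n by deflation: in an orthonormal basis whose first vector is a
    unit eigenvector, a symmetric matrix is block diagonal. *)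
Theorem real_spectral {R : rcfType} {n : nat} (A : 'M[R]_n) : A^T = A ->
  exists (Q : 'M[R]_n) (d : 'rV[R]_n),
    Q *m Q^T = 1%:M /\ A = Q *m diag_mx d *m Q^T.
Proof.
elim: n A => [|n IHn] A symA.
  by exists 1%:M, 0; split; apply/matrixP => -[].
have [a /eigenvalueP[w wA w0]] := symmetric_eigenvalue A symA.
have ww_gt0 := rv_sqnorm_gt0 w w0.
pose c := Num.sqrt ((w *m w^T) 0 0).
have c_neq0 : c != 0 by rewrite sqrtr_eq0 -ltNge.
pose u : 'rV[R]_(1 + n) := c^-1 *: w.
have uu : u *m u^T = 1%:M.
  rewrite linearZ /= -scalemxAl -scalemxAr scalerA [w *m _]mx11_scalar.
  rewrite -(sqr_sqrtr (ltW ww_gt0)) -/c scale_scalar_mx.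
  by congr (_%:M); field.
have [H HH He] := orthogonal_first_row u uu.
have HH' : H^T *m H = 1%:M := mulmx1C HH.
pose B : 'M[R]_(1 + n) := H *m A *m H^T.
have symB : B^T = B by rewrite !trmx_mul trmxK symA mulmxA.
have uA : u *m A = a *: u by rewrite -scalemxAl wA !scalerA mulrC.
have eB : (delta_mx 0 0 : 'rV_(1 + n)) *m B = a *: delta_mx 0 0.
  by rewrite !mulmxA He uA -scalemxAl -He -mulmxA HH mulmx1.
have rowB : usubmx B = row_mx a%:M 0.
  apply/rowP => j; move/rowP/(_ j): eB; rewrite -rowE !mxE => Bj.
  have -> : lshift n 0 = 0 :> 'I_(1 + n) by exact/val_inj.
  rewrite Bj; case: split_ordP => l ->; rewrite !mxE ?ord1 /=.
    by rewrite mulr_natr.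
  by rewrite mulr0.
have BE : B = block_mx a%:M 0 0 (drsubmx B).
  have ul : ulsubmx B = a%:M by rewrite /ulsubmx rowB row_mxKl.
  have ur : ursubmx B = 0 by rewrite /ursubmx rowB row_mxKr.
  have dl : dlsubmx B = 0 by rewrite -symB -trmx_ursub ur trmx0.
  by rewrite -[LHS]submxK ul ur dl.
have symB' : (drsubmx B)^T = drsubmx B by rewrite trmx_drsub symB.
have [Q [d [QQ BQ]]] := IHn _ symB'.
pose K : 'M[R]_(1 + n) := block_mx 1%:M 0 0 Q.
have KT : K^T = block_mx 1%:M 0 0 Q^T by rewrite tr_block_mx trmx1 !trmx0.
have BK : B = K *m diag_mx (row_mx a%:M d) *m K^T.
  rewrite KT diag_mx_row !mulmx_block !mul1mx !mulmx1 !mulmx0 !mul0mx.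
  rewrite !addr0 !add0r -BQ [LHS]BE.
  congr block_mx; last by rewrite mul0mx.
  by apply/matrixP => i j; rewrite !mxE !ord1.
exists (H^T *m K), (row_mx a%:M d : 'rV_(1 + n)); split.
  rewrite trmx_mul trmxK mulmxA -(mulmxA _ K) KT mulmx_block.
  rewrite !mulmx1 !mulmx0 !mul0mx !addr0 !add0r QQ -scalar_mx_block mulmx1.
  exact: HH'.
have -> : A = H^T *m B *m H by rewrite /B !mulmxA HH' mul1mx -mulmxA HH' mulmx1.
by rewrite BK trmx_mul trmxK !mulmxA.
Qed.

(** * The matrix logarithm on PSym3 *)

Lemma is_logmx_ex {R : realType} (V : 'M[R]_3) : PSym3 V -> exists X, is_logmx V X.
Proof.
move=> [symV posV]; have [Q [d [QQ VQ]]] := real_spectral V symV.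
exists (Q *m diag_mx (map_mx (@ln R) d) *m Q^T), Q, d; split=> // i.
have QQ' : Q^T *m Q = 1%:M := mulmx1C QQ.
have /posV : (delta_mx 0 i : 'rV_3) *m Q^T != 0.
  apply/eqP => /(congr1 (mulmx^~ Q)); rewrite -mulmxA QQ' mulmx1 mul0mx.
  by move/matrixP/(_ 0 i); rewrite !mxE !eqxx => /eqP; rewrite oner_eq0.
rewrite VQ trmx_mul trmxK !mulmxA.
rewrite -(mulmxA _ Q^T Q) QQ' mulmx1 -(mulmxA _ Q^T Q) QQ' mulmx1.
by rewrite -rowE trmx_delta -colE !mxE eqxx mulr1n.
Qed.

(** M = Q^T P intertwines diag c and diag d, so M i j is zero unless c j = d i;
    hence M also intertwines their images under f. *)
Lemma orthogonal_diag_map {R : idomainType} {n : nat} (f : R -> R)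
    (P Q : 'M[R]_n) (c d : 'rV[R]_n) :
  P *m P^T = 1%:M -> Q *m Q^T = 1%:M ->
  P *m diag_mx c *m P^T = Q *m diag_mx d *m Q^T ->
  P *m diag_mx (map_mx f c) *m P^T = Q *m diag_mx (map_mx f d) *m Q^T.
Proof.
move=> PP QQ; have PP' := mulmx1C PP; have QQ' := mulmx1C QQ.
pose M := Q^T *m P.
have transport (x y : 'rV[R]_n) :
    P *m diag_mx x *m P^T = Q *m diag_mx y *m Q^T <->
    M *m diag_mx x = diag_mx y *m M.
  split=> [E|E].
    have := congr1 (fun Z => Q^T *m Z *m P) E.
    by rewrite /M !mulmxA QQ' mul1mx -!mulmxA PP' mulmx1.
  have := congr1 (fun Z => Q *m Z *m P^T) E.
  by rewrite /M !mulmxA QQ mul1mx -!mulmxA PP mulmx1.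
move=> /transport E; apply/transport; clearbody M; apply/matrixP => i j.
move/matrixP/(_ i j): E; rewrite !mul_mx_diag !mul_diag_mx !mxE.
rewrite (mulrC (d 0 i)) (mulrC (f (d 0 i))).
have [->|Mij] := eqVneq (M i j) 0; first by rewrite !mul0r.
by move=> /(mulfI Mij) ->.
Qed.

Lemma is_logmx_inj {R : realType} (V W X : 'M[R]_3) :
  is_logmx V X -> is_logmx W X -> V = W.
Proof.
move=> [P [c [PP c0 -> ->]]] [Q [d [QQ d0 -> E]]].
have lnK' (x : 'rV[R]_3) : (forall i, 0 < x 0 i) ->
    map_mx (@expR R) (map_mx (@ln R) x) = x.
  by move=> x0; apply/rowP => i; rewrite !mxE lnK// posrE.
by have := orthogonal_diag_map (@expR R) _ _ _ _ PP QQ E; rewrite !lnK'.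
Qed.

Lemma logmx_inj {R : realType} (V W : 'M[R]_3) :
  PSym3 V -> PSym3 W -> logmx V = logmx W -> V = W.
Proof.
have logP (U : 'M[R]_3) : PSym3 U -> is_logmx U (logmx U).
  by move=> /is_logmx_ex[X]; exact: xgetI.
by move=> /logP logV /logP logW VW; apply: is_logmx_inj logV _; rewrite VW.
Qed.

(** * The inner product and the deviator *)

Lemma mxdotC {R : realType} (X Y : 'M[R]_3) : mxdot X Y = mxdot Y X.
Proof. by rewrite /mxdot -mxtrace_tr trmx_mul trmxK. Qed.

Lemma mxdotDl {R : realType} (X Y Z : 'M[R]_3) :
  mxdot (X + Y) Z = mxdot X Z + mxdot Y Z.
Proof. by rewrite /mxdot mulmxDl mxtraceD. Qed.

Lemma mxdotBl {R : realType} (X Y Z : 'M[R]_3) :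
  mxdot (X - Y) Z = mxdot X Z - mxdot Y Z.
Proof. by rewrite /mxdot mulmxBl raddfB. Qed.

Lemma mxdotZl {R : realType} (c : R) (X Z : 'M[R]_3) :
  mxdot (c *: X) Z = c * mxdot X Z.
Proof. by rewrite /mxdot -scalemxAl mxtraceZ. Qed.

Lemma mxdotDr {R : realType} (X Y Z : 'M[R]_3) :
  mxdot Z (X + Y) = mxdot Z X + mxdot Z Y.
Proof. by rewrite mxdotC mxdotDl !(mxdotC Z). Qed.

Lemma mxdotZr {R : realType} (c : R) (X Z : 'M[R]_3) :
  mxdot Z (c *: X) = c * mxdot Z X.
Proof. by rewrite mxdotC mxdotZl mxdotC. Qed.

Lemma mxdot1l {R : realType} (X : 'M[R]_3) : mxdot 1%:M X = \tr X.
Proof. by rewrite /mxdot mul1mx mxtrace_tr. Qed.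

Lemma mxnorm2E {R : realType} (X : 'M[R]_3) :
  mxnorm2 X = \sum_i \sum_j X i j ^+ 2.
Proof.
rewrite /mxnorm2 /mxdot /mxtrace; apply: eq_bigr => i _.
by rewrite mxE; apply: eq_bigr => j _; rewrite mxE expr2.
Qed.

Lemma mxnorm2_ge0 {R : realType} (X : 'M[R]_3) : 0 <= mxnorm2 X.
Proof.
by rewrite mxnorm2E; do 2![apply: sumr_ge0 => ? _]; exact: sqr_ge0.
Qed.

Lemma mxnorm2_eq0 {R : realType} (X : 'M[R]_3) : mxnorm2 X = 0 -> X = 0.
Proof.
rewrite mxnorm2E => /eqP.
have rge0 i : 0 <= \sum_j X i j ^+ 2 by apply: sumr_ge0 => j _; exact: sqr_ge0.
rewrite psumr_eq0 // => /allP X0; apply/matrixP => i j; rewrite [RHS]mxE.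
have /= := X0 i (mem_index_enum i).
rewrite psumr_eq0; last by move=> *; exact: sqr_ge0.
by move=> /allP/(_ j (mem_index_enum j)); rewrite /= sqrf_eq0 => /eqP.
Qed.

Lemma mxnorm2_line {R : realType} (X H : 'M[R]_3) (r : R) :
  mxnorm2 (X + r *: H)
  = mxnorm2 X + 2 * mxdot X H * r + mxnorm2 H * r ^+ 2.
Proof.
rewrite /mxnorm2 mxdotDl !mxdotDr !mxdotZl !mxdotZr (mxdotC H X).
by ring.
Qed.

Lemma mxdot_CauchySchwarz {R : realType} (X Y : 'M[R]_3) :
  mxdot X Y ^+ 2 <= mxnorm2 X * mxnorm2 Y.
Proof.
have := mxnorm2_ge0 Y; rewrite le_eqVlt => /predU1P[/esym Y0|Y_gt0].
  rewrite Y0 (mxnorm2_eq0 _ Y0) mulr0 mxdotC.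
  by rewrite -(scale0r (0 : 'M[R]_3)) mxdotZl mul0r expr0n.
(* the point closest to 0 on the line through X with direction Y *)
have := mxnorm2_ge0 (X + (- (mxdot X Y / mxnorm2 Y)) *: Y).
rewrite mxnorm2_line -(pmulr_lge0 _ Y_gt0); apply: etrans.
rewrite -subr_ge0; congr (0 <= _).
by field; rewrite gt_eqF.
Qed.

Lemma dev3D {R : realType} (X Y : 'M[R]_3) : dev3 (X + Y) = dev3 X + dev3 Y.
Proof. by rewrite /dev3 mxtraceD mulrDr scalerDl opprD addrACA. Qed.

Lemma dev3Z {R : realType} (c : R) (X : 'M[R]_3) : dev3 (c *: X) = c *: dev3 X.
Proof. by rewrite /dev3 mxtraceZ scalerBr scalerA mulrCA. Qed.

Lemma mxtrace_dev3 {R : realType} (X : 'M[R]_3) : \tr (dev3 X) = 0.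
Proof. by rewrite /dev3 raddfB /= mxtraceZ mxtrace1; field. Qed.

Lemma dev3_dev3 {R : realType} (X : 'M[R]_3) : dev3 (dev3 X) = dev3 X.
Proof. by rewrite {1}/dev3 mxtrace_dev3 mulr0 scale0r subr0. Qed.

Lemma dev3_1 {R : realType} : dev3 (1%:M : 'M[R]_3) = 0.
Proof. by rewrite /dev3 mxtrace1 mulVf ?scale1r ?subrr// pnatr_eq0. Qed.

Lemma mxdot_dev3 {R : realType} (X H : 'M[R]_3) :
  mxdot (dev3 X) H = mxdot (dev3 X) (dev3 H).
Proof.
rewrite {3}/dev3 -scaleNr mxdotDr mxdotZr (mxdotC _ 1%:M) mxdot1l mxtrace_dev3.
by rewrite mulr0 addr0.
Qed.

(** Only the deviatoric part of the strain enters, and it does so through an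
    increasing function of its norm: this turns the yield condition into a ball. *)
Lemma mxnorm2_dev3_tau_eH {R : realType} (mu kappa k khat : R) (X : 'M[R]_3) :
  mxnorm2 (dev3 (tau_eH mu kappa k khat X))
  = (2 * mu) ^+ 2 * (mxnorm2 (dev3 X) * expR (2 * k * mxnorm2 (dev3 X))).
Proof.
rewrite /tau_eH dev3D !dev3Z dev3_1 scaler0 addr0 dev3_dev3.
rewrite {1}/mxnorm2 mxdotZl mxdotZr -/(mxnorm2 _).
have -> : 2 * k * mxnorm2 (dev3 X) = k * mxnorm2 (dev3 X) + k * mxnorm2 (dev3 X).
  by ring.
by rewrite expRD; ring.
Qed.

(** * Strict monotonicity of the Cauchy stress *)

(** Positivity of the tangent form, where T and h are the traces of the strain and
    of the direction, S and q the squared norms of their deviators, and P the inner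
    product of these deviators. After the lower bound m for 1 - T + 2 khat T^2,
    what is left is a quadratic in h with negative discriminant. *)
Lemma tangent_gt0 {R : realType} (mu kappa k khat s0 T q P S h : R) :
  0 < mu -> 0 < kappa -> 0 <= k -> 1 / 8 < khat ->
  mu * s0 * expR (k * s0) < 2 * kappa * (1 - (8 * khat)^-1) ->
  0 <= q -> P ^+ 2 <= S * q -> 0 <= S <= s0 -> (q != 0) || (h != 0) ->
  0 < 2 * mu * expR (k * S) * (q - h * P + 2 * k * P ^+ 2)
      + kappa * expR (khat * T ^+ 2) * (1 - T + 2 * khat * T ^+ 2) * h ^+ 2.
Proof.
move=> mu0 kap0 k0 khat8 small q0 CS /andP[S0 Ss0] qh.
have khat0 : 0 < khat by lra.
set m := 1 - (8 * khat)^-1 in small.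
have m0 : 0 < m by rewrite subr_gt0 invf_lt1; lra.
have mT : m <= 1 - T + 2 * khat * T ^+ 2.
  rewrite -subr_ge0; have -> : 1 - T + 2 * khat * T ^+ 2 - m =
    2 * khat * (T - (4 * khat)^-1) ^+ 2 by rewrite /m; field; rewrite gt_eqF.
  by rewrite mulr_ge0 ?sqr_ge0 ?mulr_ge0 ?ltW.
set al := 2 * mu * expR (k * S); set be := kappa * m.
have al0 : 0 < al by rewrite !mulr_gt0 ?expR_gt0.
have be0 : 0 < be by rewrite mulr_gt0.
have alS : al * S < 4 * be.
  have SE : S * expR (k * S) <= s0 * expR (k * s0).
    by apply: ler_pM => //; rewrite ?expR_ge0 ?ler_expR ?ler_wpM2l.
  have : mu * (S * expR (k * S)) <= mu * (s0 * expR (k * s0)).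
    by rewrite ler_pM2l.
  by rewrite /al /be; lra.
have F1 : be <= kappa * expR (khat * T ^+ 2) * (1 - T + 2 * khat * T ^+ 2).
  rewrite /be -mulrA ler_pM2l// -[leLHS]mul1r ler_pM// ?(ltW m0)//.
  by rewrite -expR0 ler_expR mulr_ge0 ?sqr_ge0 ?(ltW khat0).
apply: (@lt_le_trans _ _ (al * (q - h * P) + be * h ^+ 2)); last first.
  apply: lerD; last by apply: ler_wpM2r; rewrite ?sqr_ge0.
  by rewrite ler_pM2l// lerDl mulr_ge0 ?sqr_ge0 ?mulr_ge0.
have [q_eq0|q_neq0] := eqVneq q 0.
  have P_eq0 : P = 0.
    by apply/eqP; rewrite -sqrf_eq0 eq_le sqr_ge0 (le_trans CS)// q_eq0 mulr0.
  have h_neq0 : h != 0 by rewrite q_eq0 eqxx in qh.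
  by rewrite q_eq0 P_eq0 mulr0 subrr mulr0 add0r mulr_gt0// exprn_even_gt0.
have q_gt0 : 0 < q by rewrite lt_def q_neq0.
have be4 : 0 < 4 * be by rewrite mulr_gt0.
(* the factor 4 be completes the square in h without dividing *)
rewrite -(pmulr_rgt0 _ be4).
have -> : 4 * be * (al * (q - h * P) + be * h ^+ 2) =
  (2 * be * h - al * P) ^+ 2 + al * (4 * be * q - al * P ^+ 2) by ring.
apply: ltr_wpDl; first exact: sqr_ge0.
rewrite mulr_gt0// subr_gt0.
apply: (@le_lt_trans _ _ (al * S * q)); first by rewrite -mulrA ler_pM2l.
by rewrite ltr_pM2r.
Qed.

(** S' = 2 P and T' = h, so the derivative is the tangent form of [tangent_gt0]
    times exp (- T). *)
Lemma is_derive_stress_line {R : realType}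
    (mu kappa k khat a b q t h r : R) :
  let T := fun r : R => t + h * r in
  let P := fun r : R => b + q * r in
  let S := fun r : R => a + 2 * b * r + q * r ^+ 2 in
  is_derive r 1 (fun r =>
      expR (- T r) * (2 * mu * expR (k * S r) * P r
                      + kappa * expR (khat * T r ^+ 2) * T r * h))
    (expR (- T r) * (2 * mu * expR (k * S r) * (q - h * P r + 2 * k * P r ^+ 2)
      + kappa * expR (khat * T r ^+ 2) * (1 - T r + 2 * khat * T r ^+ 2)
        * h ^+ 2)).
Proof.
move=> T P S.
have dT : is_derive r 1 T h.
  by apply: is_derive_eq; rewrite /GRing.scale /=; ring.
have dP : is_derive r 1 P q.
  by apply: is_derive_eq; rewrite /GRing.scale /=; ring.
have dS : is_derive r 1 S (2 * P r).
  apply: is_derive_eq; rewrite /GRing.scale /= /P.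
  by ring.
apply: is_derive_eq; rewrite /GRing.scale /=.
by ring.
Qed.

Lemma mxdot_sigma_eH_line {R : realType} (mu kappa k khat : R)
    (X H : 'M[R]_3) (r : R) :
  let D := dev3 X in
  let E := dev3 H in
  let T := \tr X + \tr H * r in
  mxdot (sigma_eH mu kappa k khat (X + r *: H)) H
  = expR (- T)
    * (2 * mu * expR (k * (mxnorm2 D + 2 * mxdot D E * r + mxnorm2 E * r ^+ 2))
         * (mxdot D E + mxnorm2 E * r)
       + kappa * expR (khat * T ^+ 2) * T * \tr H).
Proof.
move=> D E T; rewrite /sigma_eH /tau_eH mxtraceD mxtraceZ (mulrC r) -/T.
rewrite dev3D dev3Z mxnorm2_line -/D -/E.
rewrite mxdotZl mxdotDl !mxdotZl mxdot1l mxdotDl mxdotZl.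
have devH Y : mxdot (dev3 Y) H = mxdot (dev3 Y) E := mxdot_dev3 Y H.
by rewrite !devH -/D -/(mxnorm2 E) (mulrC r).
Qed.

(** Mean value theorem for r |-> <sigma (X2 + r (X1 - X2)), X1 - X2> on [0, 1]:
    the segment stays in the ball |dev3 X|^2 <= s0, where the tangent form is
    positive. *)
Lemma sigma_eH_strict_mono {R : realType} (mu kappa k khat s0 : R)
    (X1 X2 : 'M[R]_3) :
  0 < mu -> 0 < kappa -> 0 <= k -> 1 / 8 < khat ->
  mu * s0 * expR (k * s0) < 2 * kappa * (1 - (8 * khat)^-1) ->
  mxnorm2 (dev3 X1) <= s0 -> mxnorm2 (dev3 X2) <= s0 -> X1 <> X2 ->
  0 < mxdot (sigma_eH mu kappa k khat X1 - sigma_eH mu kappa k khat X2)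
            (X1 - X2).
Proof.
move=> mu0 kap0 k0 khat8 small X1s0 X2s0 X12.
set H := X1 - X2.
pose D := dev3 X2; pose E := dev3 H.
have nz : (mxnorm2 E != 0) || (\tr H != 0).
  rewrite -negb_and; apply/negP => /andP[/eqP/mxnorm2_eq0 E0 /eqP h0].
  apply: X12; apply/eqP; rewrite -subr_eq0 -/H.
  by move: E0; rewrite /E /dev3 h0 mulr0 scale0r subr0 => ->.
have X1E : X2 + 1 *: H = X1 by rewrite scale1r addrC subrK.
pose P r := mxdot D E + mxnorm2 E * r.
pose S r := mxnorm2 D + 2 * mxdot D E * r + mxnorm2 E * r ^+ 2.
have SE r : S r = mxnorm2 (dev3 (X2 + r *: H)).
  by rewrite dev3D dev3Z mxnorm2_line.
have S_bound r : 0 <= r <= 1 -> 0 <= S r <= s0.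
  move=> /andP[r0 r1]; rewrite {1}SE mxnorm2_ge0 /=.
  have -> : S r = (1 - r) * S 0 + r * S 1 - r * (1 - r) * mxnorm2 E.
    by rewrite /S; ring.
  rewrite (SE 1) X1E (SE 0) scale0r addr0.
  have E0 := mxnorm2_ge0 E.
  have : 0 <= r * (1 - r) * mxnorm2 E by rewrite !mulr_ge0// subr_ge0.
  have : (1 - r) * mxnorm2 (dev3 X2) <= (1 - r) * s0.
    by rewrite ler_wpM2l// subr_ge0.
  have : r * mxnorm2 (dev3 X1) <= r * s0 by rewrite ler_wpM2l.
  by lra.
have CS r : P r ^+ 2 <= S r * mxnorm2 E.
  have -> : P r = mxdot (dev3 (X2 + r *: H)) E.
    by rewrite dev3D dev3Z mxdotDl mxdotZl mulrC.
  by rewrite SE; exact: mxdot_CauchySchwarz.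
pose g r := mxdot (sigma_eH mu kappa k khat (X2 + r *: H)) H.
have dg r := is_derive_stress_line mu kappa k khat (mxnorm2 D) (mxdot D E)
  (mxnorm2 E) (\tr X2) (\tr H) r.
have gE : g = fun r => _ := funext (mxdot_sigma_eH_line mu kappa k khat X2 H).
rewrite mxdotBl subr_gt0.
suff : g 0 < g 1 by rewrite /g X1E scale0r addr0.
have [|c /itvP c01 gc] := MVT (@ltr01 R) (fun r _ => dg r).
  apply: derivable_within_continuous => r _.
  by have [] := dg r.
rewrite -subr_gt0 gE gc subr0 mulr1 mulr_gt0 ?expR_gt0//.
apply: (@tangent_gt0 _ mu kappa k khat s0 (\tr X2 + \tr H * c) (mxnorm2 E)
  (P c) (S c) (\tr H)) => //.
- exact: mxnorm2_ge0.
- by apply: S_bound; rewrite !c01.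
Qed.

(** * The choice of the parameters *)

Theorem proposition4p7 (R : realType) (mu kappa : R) (mu_gt0 : 0 < mu)
    (kappa_gt0 : 0 < kappa) :
  exists khat k : R,
    [/\ 1 / 8 < khat, 0 < k &
      forall sigma_y : R,
        0 < sigma_y ^+ 2 ->
        sigma_y ^+ 2 <= 3 * mu * kappa / expR 1 * ((8 * khat - 1) / khat)
          * expR (k * (kappa / (expR 1 * mu)) * ((8 * khat - 1) / khat)) ->
        tsts_mplus_on (sigma_eH mu kappa k khat)
                      (elastic_domain mu kappa k khat sigma_y)].
Proof.
have e_gt0 := expR_gt0 (1 : R).
pose s0 : R := 2 * kappa / (expR 1 * mu).
have s0_gt0 : 0 < s0 by rewrite divr_gt0 ?mulr_gt0.
pose k := (8 * s0)^-1.
have k_gt0 : 0 < k by rewrite invr_gt0 mulr_gt0.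
have khatE : (8 * (1 / 4) - 1) / (1 / 4) = 4 :> R by field.
exists (1 / 4), k; split=> [|//|s _]; first by lra.
rewrite khatE => s_le V1 V2 [psym1 dom1] [psym2 dom2] V12.
have in_ball (V : 'M[R]_3) :
    mxnorm2 (dev3 (tau_eH mu kappa k (1 / 4) (logmx V))) <= 2 / 3 * s ^+ 2 ->
    mxnorm2 (dev3 (logmx V)) <= s0.
  rewrite mxnorm2_dev3_tau_eH => le_s; rewrite leNgt; apply/negP => gt_s0.
  suff : (2 * mu) ^+ 2 * (s0 * expR (2 * k * s0)) < 2 / 3 * s ^+ 2.
    apply/negP; rewrite -leNgt.
    have -> : (2 * mu) ^+ 2 * (s0 * expR (2 * k * s0)) =
        2 / 3 * (3 * mu * kappa / expR 1 * 4
          * expR (k * (kappa / (expR 1 * mu)) * 4)).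
      have -> : k * (kappa / (expR 1 * mu)) * 4 = 2 * k * s0.
        by rewrite /s0; field; rewrite !gt_eqF.
      by rewrite /s0; field; rewrite !gt_eqF.
    by rewrite ler_pM2l// divr_gt0.
  apply: lt_le_trans le_s; rewrite ltr_pM2l ?exprn_gt0 ?mulr_gt0//.
  apply: ltr_pM => //; rewrite ?expR_ge0 ?(ltW s0_gt0)// ltr_expR ltr_pM2l//.
  by rewrite mulr_gt0.
apply: (@sigma_eH_strict_mono _ mu kappa k (1 / 4) s0) => //.
- exact: ltW.
- lra.
(* the smallness condition is exp (7/8) > 2, which follows from
   exp (7/16) >= 23/16 *)
- have -> : k * s0 = 1 / 8 by rewrite /k; field; rewrite gt_eqF.
  have -> : mu * s0 * expR (1 / 8) = 2 * kappa * expR (- (7 / 8)).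
    have -> : - (7 / 8) = 1 / 8 - 1 :> R by lra.
    by rewrite expRB /s0; field; rewrite !gt_eqF.
  rewrite ltr_pM2l ?mulr_gt0//.
  have -> : 1 - (8 * (1 / 4))^-1 = 2^-1 :> R by field.
  rewrite expRN ltf_pV2 ?posrE ?expR_gt0//.
  have -> : 7 / 8 = 7 / 16 + 7 / 16 :> R by lra.
  have e716 := expR_ge1Dx (7 / 16 : R).
  by rewrite expRD; nra.
- exact: in_ball.
- exact: in_ball.
- by move/logmx_inj => /(_ psym1 psym2)/V12.
Qed.
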